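(* Let $\Phi\in\mathcal{E}_0(I)$ and let $f,g:I\to\mathbb{R}$ be such that $g\leq h\leq f$ for some $\Phi$-convex function $h:I\to\mathbb{R}$. Then, for all $x,y\in I$ and $t\in[0,1]$, the functional inequality $$g(tx+(1-t)y)\leq tf(x)+(1-t)f(y)+t\Phi((1-t)|y-x|)+(1-t)\Phi(t|y-x|)\qquad( * )$$ holds. Conversely, if $\Phi\in\mathcal{E}_0(I)$ is such that the function $\Psi(u):=-\Phi(|u|)$ is $\Phi$-convex on $J:=I-I=\{x-y:x,y\in I\}$, and $f,g:I\to\mathbb{R}$ satisfy $( * )$ for all $x,y\in I$ and $t\in[0,1]$, then there exists a $\Phi$-convex function $h:I\to\mathbb{R}$ such that $g\leq h\leq f$ holds on $I$.
   Context: $I\subseteq\mathbb{R}$ is a nonempty open interval and $\ell(I)\in(0,\infty]$ is its length. $\mathcal{E}(I)$ is the set of all functions $\Phi:[0,\ell(I))\to[0,\infty)$ (called error functions), and $\mathcal{E}_0(I)$ is the set of those $\Phi\in\mathcal{E}(I)$ with $\Phi(0)=0$. A function $f:I\to\mathbb{R}$ is called $\Phi$-convex if for all $x,y\in I$ and $t\in[0,1]$, $$f(tx+(1-t)y)\leq tf(x)+(1-t)f(y)+t\Phi((1-t)|x-y|)+(1-t)\Phi(t|x-y|).$$ The $\Phi$-convexity of $\Psi$ on $J=(-\ell(I),\ell(I))$ means the same inequality (with $\Psi$ in place of $f$) for all $t\in[0,1]$ and all $x,y\in J$ with $|x-y|<\ell(I)$. *)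

(* Defs.v *)
(* MathComp: the reals are an arbitrary [R : realType]. *)
From HB Require Import structures.
From mathcomp Require Import all_boot all_order all_algebra.
From mathcomp Require Import all_classical all_reals all_analysis.

Set Implicit Arguments.
Unset Strict Implicit.
Unset Printing Implicit Defensive.

Import Order.TTheory GRing.Theory Num.Theory.
Import numFieldNormedType.Exports.

Local Open Scope classical_set_scope.
Local Open Scope ring_scope.

Definition nonempty_open_interval (R : realType) (I : set R) : Prop :=
  [/\ I !=set0, open I & is_interval I].

(* For an unbounded [I] the difference is [+oo] (in [\bar R], [+oo - -oo = +oo]). *)
Definition interval_length (R : realType) (I : set R) : \bar R :=
  (ereal_sup (EFin @` I) - ereal_inf (EFin @` I))%E.

(* Functions with domain [0, interval_length I[ or I are represented by total functions
   [R -> R]; no definition below depends on their values off these domains. *)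
Definition error_functions (R : realType) (I : set R) : set (R -> R) :=
  [set Phi | forall u : R, 0 <= u -> (u%:E < interval_length I)%E -> 0 <= Phi u].

Definition error_functions0 (R : realType) (I : set R) : set (R -> R) :=
  [set Phi | error_functions I Phi /\ Phi 0 = 0].

Definition convexity_bound (R : realType) (Phi f : R -> R) (x y t : R) : R :=
  t * f x + (1 - t) * f y
  + t * Phi ((1 - t) * `|x - y|) + (1 - t) * Phi (t * `|x - y|).

Definition Phi_convex (R : realType) (I : set R) (Phi f : R -> R) : Prop :=
  forall x y t : R, I x -> I y -> 0 <= t <= 1 ->
    f (t * x + (1 - t) * y) <= convexity_bound Phi f x y t.

Definition difference_set (R : realType) (I : set R) : set R :=
  [set x - y | x in I & y in I].

(* On [I - I] two points may be at distance [>= interval_length I], where [Phi] is not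
   defined, hence the extra restriction on [x] and [y]. *)
Definition Phi_convex_on_difference (R : realType) (I : set R)
    (Phi Psi : R -> R) : Prop :=
  forall x y t : R, difference_set I x -> difference_set I y ->
    (`|x - y|%:E < interval_length I)%E -> 0 <= t <= 1 ->
    Psi (t * x + (1 - t) * y) <= convexity_bound Phi Psi x y t.

Definition sandwich_inequality (R : realType) (I : set R)
    (Phi f g : R -> R) : Prop :=
  forall x y t : R, I x -> I y -> 0 <= t <= 1 ->
    g (t * x + (1 - t) * y) <=
      t * f x + (1 - t) * f y
      + t * Phi ((1 - t) * `|y - x|) + (1 - t) * Phi (t * `|y - x|).

Definition Phi_convex_between (R : realType) (I : set R)
    (Phi f g : R -> R) : Prop :=
  exists h : R -> R, Phi_convex I Phi h /\
    forall x : R, I x -> g x <= h x <= f x.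

(* Main.v *)
Require Import Defs.
From HB Require Import structures.
From mathcomp Require Import all_boot all_order all_algebra.
From mathcomp Require Import all_classical all_reals all_analysis.
From mathcomp Require Import ring lra.

Import Order.TTheory GRing.Theory Num.Theory.
Import numFieldNormedType.Exports.

Local Open Scope classical_set_scope.
Local Open Scope ring_scope.

(** When [Phi 0 = 0], a function [h] is Phi-convex on an open interval exactly
    when every point [u] has a slope [a] with
    [h u + a (x - u) <= h x + Phi |x - u|] for all [x], the analogue of a
    supporting line: for [u = t x + (1 - t) y] the error terms
    [Phi ((1 - t) |x - y|)] and [Phi (t |x - y|)] are [Phi |u - x|] and
    [Phi |u - y|], so Phi-convexity compares a left difference quotient at [u]
    with a right one.  The same reading of the sandwich inequality gives slopes
    [a u] with [g u + a u (x - u) <= f x + Phi |x - u|] ([sandwich_support]).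

    The separating function is the upper envelope
      [h x = sup_u (g u + a u (x - u) - Phi |x - u|)].
    The support inequality says [h <= f]; the term [u = x] gives [g <= h],
    because [Phi 0 = 0].  Each function under the supremum is an affine function
    plus a translate of [- Phi |.|], hence Phi-convex by hypothesis
    ([support_Phi_convex]), and Phi-convexity passes to suprema
    ([sup_Phi_convex]).  In the other direction, a given Phi-convex [h] between
    [g] and [f] yields the sandwich inequality by bounding [g] by [h] at the
    intermediate point and [h] by [f] at the endpoints. *)

Lemma interval_convex_comb (R : realType) (I : set R) (x y t : R) :
  is_interval I -> I x -> I y -> 0 <= t <= 1 -> I (t * x + (1 - t) * y).
Proof.
move=> iI Ix Iy /andP[t0 t1].
case: (leP x y) => xy; [apply: (iI x y) | apply: (iI y x)] => //; nra.
Qed.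

Lemma open_exists_lt_gt (R : realType) (I : set R) (u : R) : open I -> I u ->
  exists x y, [/\ I x, I y, x < u & u < y].
Proof.
move=> oI Iu; have /nbhs_ballP[e /= e0 eI] := open_nbhs_nbhs (conj oI Iu).
exists (u - e / 2), (u + e / 2); split; try lra;
  apply: eI; rewrite /ball /= ltr_norml; apply/andP; split; lra.
Qed.

(** This is what lets the Phi-convexity of [- Phi |.|] on [I - I], which is
    restricted to close points, be used for translates of points of [I]. *)
Lemma dist_lt_interval_length (R : realType) (I : set R) (x y : R) : open I ->
  I x -> I y -> (`|x - y|%:E < interval_length I)%E.
Proof.
move=> oI; wlog xy : x y / x <= y.
  move=> H Ix Iy; case: (leP x y) => [xy|/ltW xy]; first exact: H.
  by rewrite distrC; exact: H.
move=> Ix Iy.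
have [x' [_ [Ix' _ x'x _]]] := open_exists_lt_gt _ _ _ oI Ix.
have xy' : (`|x - y|%:E < y%:E - x'%:E)%E.
  by rewrite -EFinB lte_fin distrC ger0_norm; lra.
apply: (lt_le_trans xy'); apply: leeB.
- by apply: ereal_sup_ubound; exists y.
- by apply: ereal_inf_lbound; exists x'.
Qed.

(** Choosing [t] so that the convex combination is [u] makes the arguments of
    [Phi] the distances from [u]; clearing denominators leaves an inequality
    that rearranges linearly into one between difference quotients at [u]. *)
Lemma sandwich_left_right (R : realType) (I : set R) (Phi f g : R -> R)
    (x u y : R) : sandwich_inequality I Phi f g -> I x -> I y -> x < u < y ->
  (y - x) * g u <=
    (y - u) * (f x + Phi (u - x)) + (u - x) * (f y + Phi (y - u)).
Proof.
move=> sI Ix Iy /andP[xu uy].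
have yx : 0 < y - x by lra.
have yx0 : y - x != 0 by rewrite gt_eqF.
(* the weight of [x] in the convex combination of [x] and [y] equal to [u] *)
pose t := (y - u) / (y - x).
have tE : t * (y - x) = y - u by rewrite /t divfK.
have t01 : 0 <= t <= 1.
  by rewrite /t divr_ge0 ?ler_pdivrMr //; lra.
have := sI x y t Ix Iy t01.
have -> : t * x + (1 - t) * y = u by lra.
rewrite gtr0_norm // tE.
have -> : (1 - t) * (y - x) = u - x by lra.
move=> /(ler_wpM2l (ltW yx)) /le_trans; apply.
rewrite le_eqVlt; apply/orP; left; apply/eqP.
by rewrite /t; field.
Qed.

(** By the sandwich inequality every left difference quotient at [u] is at most
    every right one; openness provides both kinds, so the supremum of the
    left ones is finite and separates them. *)
Lemma sandwich_support (R : realType) (I : set R) (Phi f g : R -> R) (u : R) :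
  open I -> Phi 0 = 0 -> sandwich_inequality I Phi f g -> I u ->
  exists a, forall x, I x -> g u + a * (x - u) <= f x + Phi `|x - u|.
Proof.
move=> oI P0 sI Iu.
pose L := [set (g u - f x - Phi (u - x)) / (u - x) | x in [set x | I x /\ x < u]].
have LR y : I y -> u < y -> ubound L ((f y + Phi (y - u) - g u) / (y - u)).
  move=> Iy uy _ [x [Ix xu] <-].
  have := sandwich_left_right _ _ _ _ _ x u y sI Ix Iy.
  rewrite xu uy => /(_ isT) H.
  rewrite ler_pdivrMr ?subr_gt0// mulrAC ler_pdivlMr ?subr_gt0//.
  lra.
have [x0 [y0 [Ix0 Iy0 x0u uy0]]] := open_exists_lt_gt _ _ _ oI Iu.
have L0 : L !=set0 by exists ((g u - f x0 - Phi (u - x0)) / (u - x0)), x0.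
exists (sup L) => x Ix; case: (ltgtP x u) => [xu|ux|->].
- rewrite distrC gtr0_norm ?subr_gt0//.
  have : (g u - f x - Phi (u - x)) / (u - x) <= sup L.
    by apply: ub_le_sup; [eexists; exact: (LR y0) | exists x].
  rewrite ler_pdivrMr ?subr_gt0//; lra.
- rewrite gtr0_norm ?subr_gt0//.
  have : sup L <= (f x + Phi (x - u) - g u) / (x - u).
    by apply: ge_sup => //; exact: LR.
  rewrite ler_pdivlMr ?subr_gt0//; lra.
- have := sI u u 1 Iu Iu; rewrite ler01 lexx => /(_ isT).
  by rewrite !subrr normr0 !mulr0 !mul0r !mul1r P0 !addr0.
Qed.

(** Translating by [u] keeps distances, and an affine function takes equal
    values on both sides of the convexity inequality. *)
Lemma support_Phi_convex (R : realType) (I : set R) (Phi : R -> R) (u a c : R) :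
  open I -> Phi_convex_on_difference I Phi (fun v => - Phi `|v|) -> I u ->
  Phi_convex I Phi (fun x => c + a * (x - u) - Phi `|x - u|).
Proof.
move=> oI cJ Iu x y t Ix Iy t01.
have Jx : difference_set I (x - u) by exists x => //; exists u.
have Jy : difference_set I (y - u) by exists y => //; exists u.
have xyE : (x - u) - (y - u) = x - y by ring.
have := cJ _ _ t Jx Jy; rewrite /convexity_bound xyE.
have -> : t * (x - u) + (1 - t) * (y - u) = t * x + (1 - t) * y - u by ring.
move=> /(_ (dist_lt_interval_length _ _ _ _ oI Ix Iy) t01).
lra.
Qed.

Lemma sup_Phi_convex (R : realType) (T : Type) (A : set T) (I : set R)
    (Phi : R -> R) (F : T -> R -> R) :
  is_interval I -> A !=set0 ->
  (forall x, I x -> has_ubound [set F u x | u in A]) ->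
  (forall u, A u -> Phi_convex I Phi (F u)) ->
  Phi_convex I Phi (fun x => sup [set F u x | u in A]).
Proof.
move=> iI [u0 Au0] bF cF x y t Ix Iy t01.
apply: ge_sup; first by exists (F u0 (t * x + (1 - t) * y)), u0.
move=> _ [u Au <-]; apply: (le_trans (cF u Au x y t Ix Iy t01)).
have Fsup z : I z -> F u z <= sup [set F u z | u in A].
  by move=> Iz; apply: ub_le_sup; [exact: bF | exists u].
case/andP: t01 => t0 t1.
rewrite /convexity_bound !lerD2r lerD // ler_wpM2l ?Fsup //; lra.
Qed.

Lemma Phi_convex_between_sandwich (R : realType) (I : set R)
    (Phi f g : R -> R) :
  is_interval I -> Phi_convex_between I Phi f g -> sandwich_inequality I Phi f g.
Proof.
move=> iI [h [ch ghf]] x y t Ix Iy t01.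
have /andP[gh _] := ghf _ (interval_convex_comb _ _ _ _ _ iI Ix Iy t01).
have /andP[_ hfx] := ghf _ Ix; have /andP[_ hfy] := ghf _ Iy.
apply: (le_trans gh); apply: (le_trans (ch x y t Ix Iy t01)).
case/andP: t01 => t0 t1.
rewrite /convexity_bound (distrC x y) !lerD2r lerD // ler_wpM2l //; lra.
Qed.

Lemma sandwich_Phi_convex_between (R : realType) (I : set R)
    (Phi f g : R -> R) :
  nonempty_open_interval I -> Phi 0 = 0 ->
  Phi_convex_on_difference I Phi (fun v => - Phi `|v|) ->
  sandwich_inequality I Phi f g -> Phi_convex_between I Phi f g.
Proof.
move=> [I0 oI iI] P0 cJ sI.
have /choice[a aP] : forall u, exists a, I u ->
    forall x, I x -> g u + a * (x - u) <= f x + Phi `|x - u|.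
  move=> u; have [Iu|nIu] := pselect (I u); last by exists 0.
  by have [a aP] := sandwich_support _ _ _ _ _ _ oI P0 sI Iu; exists a.
pose F u x := g u + a u * (x - u) - Phi `|x - u|.
have Ff x : I x -> ubound [set F u x | u in I] (f x).
  by move=> Ix _ [u Iu <-]; rewrite /F lerBlDr aP.
have bF x : I x -> has_ubound [set F u x | u in I].
  by move=> Ix; exists (f x); exact: Ff.
exists (fun x => sup [set F u x | u in I]); split.
  by apply: sup_Phi_convex => // u Iu; exact: support_Phi_convex.
move=> x Ix; apply/andP; split.
- apply: ub_le_sup; first exact: bF.
  by exists x => //; rewrite /F subrr normr0 mulr0 P0 addr0 subr0.
- by apply: ge_sup; [exists (F x x), x | exact: Ff].
Qed.

Theorem theorem5p5 (R : realType) (I : set R)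
    (hI : nonempty_open_interval I)
    (Phi : R -> R) (hPhi : error_functions0 I Phi) :
  (forall f g : R -> R,
     Phi_convex_between I Phi f g -> sandwich_inequality I Phi f g)
  /\
  (Phi_convex_on_difference I Phi (fun u : R => - Phi `|u|) ->
   forall f g : R -> R,
     sandwich_inequality I Phi f g -> Phi_convex_between I Phi f g).
Proof.
have [_ _ iI] := hI; have [_ P0] := hPhi.
split=> [f g|cJ f g]; first exact: Phi_convex_between_sandwich.
exact: sandwich_Phi_convex_between.
Qed.
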